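(* Let $(M,\omega)$ be a symplectic $G$-manifold, and let $\kappa(G,G^* )$ be a dual pair of Lie groups. Assume that the $G$-action has a $G^*$-valued momentum map $J:M\to G^*$. Let $h\in C^\infty(M)$ be a smooth function for which the Hamiltonian vector field $X^h$ exists and has a unique local flow. If $h$ is $G$-invariant, then $J$ is constant along the integral curves of $X^h$.
   Context: Manifolds and Lie groups may be infinite-dimensional (modeled on locally convex spaces); symplectic forms are closed and weakly non-degenerate. A dual pair $\kappa(G,G^* )$ of Lie groups consists of Lie groups $G,G^*$ with Lie algebras $\mathfrak g,\mathfrak g^*$ and a weakly non-degenerate bilinear map $\kappa:\mathfrak g\times\mathfrak g^*\to\mathbb R$ ($\mathfrak g^*$ need not be the functional-analytic dual). A $G^*$-valued momentum map is a smooth map $J:M\to G^*$ with $A^*\lrcorner\,\omega+\kappa(A,\delta J)=0$ for all $A\in\mathfrak g$; here $A^*_m=\frac{d}{dt}|_{t=0}\exp(tA)\cdot m$ is the fundamental vector field, $A^*\lrcorner\,\omega=\omega(A^*,\cdot)$, and $\delta_mJ(X)=J(m)^{-1}\cdot T_mJ(X)\in\mathfrak g^*$ is the left logarithmic derivative. The Hamiltonian vector field is defined (if it exists) by $X^h\lrcorner\,\omega=-dh$. *)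

(* Defs.v *)
From HB Require Import structures.
From mathcomp Require Import all_boot all_order all_algebra.
From mathcomp Require Import all_classical all_reals all_analysis.

Set Implicit Arguments.
Unset Strict Implicit.
Unset Printing Implicit Defensive.

Import Order.TTheory GRing.Theory Num.Theory.
Import numFieldNormedType.Exports.

Local Open Scope classical_set_scope.
Local Open Scope ring_scope.

(* Calculus in locally convex spaces (Michal-Bastiani): a map f on an open set
   U is C^(k+1) when its directional derivatives exist and form a C^k map
   df : U x E -> F.  The derivatives 'D_v f of the library require normed
   spaces; here the spaces are only locally convex. *)

Definition diff_quotient {R : realType} {E F : tvsType R} (f : E -> F)
    (x v : E) (t : R) : F := t^-1 *: (f (x + t *: v) - f x).

Definition has_dirder {R : realType} {E F : tvsType R} (f : E -> F)
    (x v : E) (w : F) : Prop := diff_quotient f x v @ (0 : R)^' --> w.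

Definition dirder {R : realType} {E F : tvsType R} (f : E -> F)
    (x v : E) : F := xget 0 [set w | has_dirder f x v w].

Fixpoint Ck_on {R : realType} (k : nat) (E F : tvsType R) (U : set E)
    (f : E -> F) : Prop :=
  match k with
  | 0 => {in U, continuous f}
  | k.+1 => {in U, continuous f} /\
      exists2 df : E * E -> F,
        (forall x v, U x -> has_dirder f x v (df (x, v))) &
        Ck_on k (U `*` setT) df
  end.

Definition smooth_on {R : realType} {E F : tvsType R} (U : set E)
  (f : E -> F) : Prop := forall k, Ck_on k U f.

Lemma continuous_in_prod (A1 A2 B1 B2 : topologicalType) (V1 : set A1)
    (V2 : set A2) (g1 : A1 -> B1) (g2 : A2 -> B2) :
  {in V1, continuous g1} -> {in V2, continuous g2} ->
  {in V1 `*` V2, continuous (fun p => (g1 p.1, g2 p.2))}.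
Proof.
move=> c1 c2 p /set_mem [V1p V2p]; apply: cvg_pair => /=.
  by apply: continuous_comp; [exact: cvg_fst|exact/c1/mem_set].
by apply: continuous_comp; [exact: cvg_snd|exact/c2/mem_set].
Qed.

Lemma open_prod (S T : topologicalType) (A : set S) (B : set T) :
  open A -> open B -> open (A `*` B).
Proof.
move=> oA oB; rewrite openE => -[a b] [Aa Bb]; exists (A, B) => //.
by split; exact: open_nbhs_nbhs.
Qed.

Section CkTheory.
Variable R : realType.

Lemma Ck_on_sub k (E F : tvsType R) (U V : set E) (f : E -> F) :
  V `<=` U -> Ck_on k U f -> Ck_on k V f.
Proof.
elim: k E F U V f => [|k IH] E F U V f VU /=.
  by move=> fc x /set_mem/VU/mem_set; exact: fc.
move=> [fc [df fdf dfk]]; split.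
  by move=> x /set_mem/VU/mem_set; exact: fc.
exists df; first by move=> x v /VU; exact: fdf.
by apply: IH dfk => -[x v] /= [/VU].
Qed.

Lemma has_dirder_linear (E F : tvsType R) (f : E -> F) x v :
  linear f -> has_dirder f x v (f v).
Proof.
move=> fl; apply: cvg_near_cst.
near=> t.
have t0 : t != 0 by near: t; exact: nbhs_dnbhs_neq.
by rewrite /diff_quotient [x + _]addrC fl addrK scalerA mulVf// scale1r.
Unshelve. all: by end_near. Qed.

Lemma Ck_on_linear k (E F : tvsType R) (U : set E) (f : E -> F) :
  linear f -> continuous f -> Ck_on k U f.
Proof.
elim: k E F U f => [|k IH] E F U f fl fc /=; first by move=> x _; exact: fc.
split; first by move=> x _; exact: fc.
exists (f \o snd); first by move=> x v _; exact: has_dirder_linear.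
apply: IH; first by move=> t u v; exact: fl.
by move=> p; apply: continuous_comp; [exact: cvg_snd|exact: fc].
Qed.

Lemma Ck_on_comp_linear k (D E F : tvsType R) (U : set E) (f : E -> F)
    (l : D -> E) : linear l -> continuous l ->
  Ck_on k U f -> Ck_on k (l @^-1` U) (f \o l).
Proof.
elim: k D E F U f l => [|k IH] D E F U f l ll lc /=.
  move=> fc x /set_mem Ulx.
  by apply: continuous_comp; [exact: lc|exact/fc/mem_set].
move=> [fc [df fdf dfk]]; split.
  move=> x /set_mem Ulx.
  by apply: continuous_comp; [exact: lc|exact/fc/mem_set].
pose l2 (p : D * D) := (l p.1, l p.2).
exists (df \o l2).
  move=> x v Ulx; rewrite /has_dirder (_ : diff_quotient _ _ _ =
    diff_quotient f (l x) (l v)); first exact: fdf.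
  by apply/funext => t; rewrite /diff_quotient /= [x + _]addrC ll [_ + l x]addrC.
apply: (@Ck_on_sub _ _ _ (l2 @^-1` (U `*` setT))) => //.
apply: IH dfk.
  by move=> t u v; rewrite /l2 /= !ll.
move=> p; apply: cvg_pair => /=.
  by apply: continuous_comp; [exact: cvg_fst|exact: lc].
by apply: continuous_comp; [exact: cvg_snd|exact: lc].
Qed.

Lemma Ck_on_prod k (E1 E2 F1 F2 : tvsType R) (U1 : set E1) (U2 : set E2)
    (f1 : E1 -> F1) (f2 : E2 -> F2) :
  Ck_on k U1 f1 -> Ck_on k U2 f2 ->
  Ck_on k (U1 `*` U2) (fun p => (f1 p.1, f2 p.2)).
Proof.
elim: k E1 E2 F1 F2 U1 U2 f1 f2 => [|k IH] E1 E2 F1 F2 U1 U2 f1 f2 /=.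
  exact: continuous_in_prod.
move=> [c1 [df1 fdf1 dfk1]] [c2 [df2 fdf2 dfk2]]; split; first exact: continuous_in_prod.
pose s (p : (E1 * E2) * (E1 * E2)) := ((p.1.1, p.2.1), (p.1.2, p.2.2)).
pose df (q : (E1 * E1) * (E2 * E2)) := (df1 q.1, df2 q.2).
exists (df \o s).
  move=> [x1 x2] [v1 v2] [/= Ux1 Ux2].
  exact: (cvg_pair (fdf1 x1 v1 Ux1) (fdf2 x2 v2 Ux2)).
apply: (@Ck_on_sub _ _ _ (s @^-1` ((U1 `*` setT) `*` (U2 `*` setT)))).
  by move=> [[x1 x2] [v1 v2]] /= [[]].
apply: Ck_on_comp_linear; [by []| |exact: IH].
have pairc (S T1 T2 : topologicalType) (g1 : S -> T1) (g2 : S -> T2) :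
    continuous g1 -> continuous g2 -> continuous (fun p => (g1 p, g2 p)).
  by move=> g1c g2c p; exact: (cvg_pair (g1c p) (g2c p)).
have fstc (S T : topologicalType) : continuous (@fst S T).
  by move=> p; exact: cvg_fst.
have sndc (S T : topologicalType) : continuous (@snd S T).
  by move=> p; exact: cvg_snd.
have compc (S T Z : topologicalType) (g1 : S -> T) (g2 : T -> Z) :
    continuous g1 -> continuous g2 -> continuous (g2 \o g1).
  by move=> g1c g2c p; apply: continuous_comp; [exact: g1c|exact: g2c].
by apply: (pairc); apply: (pairc); apply: compc; (exact: fstc || exact: sndc).
Qed.

End CkTheory.

Record chart {R : realType} (E : tvsType R) (M : topologicalType) := Chart {
  chart_dom : set M;
  chart_cod : set E;
  chart_fun :> M -> E;
  chart_inv : E -> M;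
  open_chart_dom : open chart_dom;
  open_chart_cod : open chart_cod;
  chart_funP : forall m, chart_dom m -> chart_cod (chart_fun m);
  chart_invP : forall x, chart_cod x -> chart_dom (chart_inv x);
  chart_funK : forall m, chart_dom m -> chart_inv (chart_fun m) = m;
  chart_invK : forall x, chart_cod x -> chart_fun (chart_inv x) = x;
  continuous_chart_fun : {in chart_dom, continuous chart_fun};
  continuous_chart_inv : {in chart_cod, continuous chart_inv}
}.

Record manifold (R : realType) (E : tvsType R) := Manifold {
  carrier :> topologicalType;
  hausdorff_model : hausdorff_space E;
  hausdorff_manifold : hausdorff_space carrier;
  atlas : set (chart E carrier);
  atlas_cover : forall m, exists2 phi, atlas phi & chart_dom phi m;
  atlas_compat : forall phi psi, atlas phi -> atlas psi ->
    smooth_on (chart_cod phi `&` chart_inv phi @^-1` chart_dom psi)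
      (psi \o chart_inv phi)
}.

Section ModelManifold.
Variables (R : realType) (E : tvsType R) (hE : hausdorff_space E).

Definition id_chart : chart E E.
Proof.
by refine (@Chart R E E setT setT id id openT openT _ _ _ _ _ _) => // x _;
  exact: cvg_id.
Defined.

Let id_cover (m : E) : exists2 phi, [set id_chart] phi & chart_dom phi m.
Proof. by exists id_chart. Qed.

Let id_compat (phi psi : chart E E) :
  [set id_chart] phi -> [set id_chart] psi ->
  smooth_on (chart_cod phi `&` chart_inv phi @^-1` chart_dom psi)
    (psi \o chart_inv phi).
Proof. by move=> -> -> k; apply: Ck_on_linear => // x; exact: cvg_id. Qed.

Definition model_manifold : manifold E :=
  @Manifold R E E hE hE [set id_chart] id_cover id_compat.

End ModelManifold.

Definition line (R : realType) : manifold R^o :=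
  model_manifold (@Rhausdorff R : hausdorff_space R^o).

Section ProductManifold.
Variables (R : realType) (E F : tvsType R).

Lemma hausdorff_prod (S T : topologicalType) :
  hausdorff_space S -> hausdorff_space T -> hausdorff_space (S * T)%type.
Proof.
move=> hS hT [a b] [c d] cl; congr pair.
  apply: hS => A B nA nB.
  have [] := cl (A `*` setT) (B `*` setT).
  - by exists (A, setT) => //; split => //; exact: filterT.
  - by exists (B, setT) => //; split => //; exact: filterT.
  by move=> [x y] [[Ax _] [Bx _]]; exists x.
apply: hT => A B nA nB.
have [] := cl (setT `*` A) (setT `*` B).
- by exists (setT, A) => //; split => //; exact: filterT.
- by exists (setT, B) => //; split => //; exact: filterT.
by move=> [x y] [[_ Ay] [_ By]]; exists y.
Qed.

Variables (M : manifold E) (N : manifold F).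

Definition prod_chart (phi : chart E M) (psi : chart F N) :
  chart (E * F)%type (M * N)%type.
Proof.
refine (@Chart R (E * F)%type (M * N)%type
  (chart_dom phi `*` chart_dom psi) (chart_cod phi `*` chart_cod psi)
  (fun p => (phi p.1, psi p.2)) (fun x => (chart_inv phi x.1, chart_inv psi x.2))
  _ _ _ _ _ _ _ _).
- by apply: open_prod; exact: open_chart_dom.
- by apply: open_prod; exact: open_chart_cod.
- by move=> p [? ?]; split; exact: chart_funP.
- by move=> x [? ?]; split; exact: chart_invP.
- by move=> [m n] [? ?]; rewrite /= !chart_funK.
- by move=> [x y] [? ?]; rewrite /= !chart_invK.
- by apply: continuous_in_prod; exact: continuous_chart_fun.
- by apply: continuous_in_prod; exact: continuous_chart_inv.
Defined.

Definition prod_atlas : set (chart (E * F)%type (M * N)%type) :=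
  [set c | exists phi psi, [/\ atlas phi, atlas psi & c = prod_chart phi psi]].

Let prod_cover (p : (M * N)%type) :
  exists2 c, prod_atlas c & chart_dom c p.
Proof.
have [phi aphi dphi] := atlas_cover p.1.
have [psi apsi dpsi] := atlas_cover p.2.
by exists (prod_chart phi psi) => //; exists phi, psi.
Qed.

Let prod_compat (c d : chart (E * F)%type (M * N)%type) :
  prod_atlas c -> prod_atlas d ->
  smooth_on (chart_cod c `&` chart_inv c @^-1` chart_dom d) (d \o chart_inv c).
Proof.
move=> [phi [psi [aphi apsi ->]]] [phi' [psi' [aphi' apsi' ->]]] k.
apply: Ck_on_sub (Ck_on_prod (atlas_compat aphi aphi' k)
  (atlas_compat apsi apsi' k)).
by move=> [x y] [[/= ? ?] [/= ? ?]].
Qed.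

Definition prod_manifold : manifold (E * F)%type :=
  @Manifold R (E * F)%type (M * N)%type
    (hausdorff_prod (@hausdorff_model _ _ M) (@hausdorff_model _ _ N))
    (hausdorff_prod (@hausdorff_manifold _ _ M) (@hausdorff_manifold _ _ N))
    prod_atlas prod_cover prod_compat.

End ProductManifold.

(* The tangent space at m is the model space E, a vector of E standing for the
   tangent vector with these coordinates in the preferred chart [chart_at m].
   Hence equal points, even if not convertible, have tangent spaces which are
   the same up to conversion. *)

Definition chart_at {R : realType} {E : tvsType R} {M : manifold E} (m : M) :
  chart E M := s2val (cid2 (atlas_cover m)).

Definition tangent {R : realType} {E : tvsType R} (M : manifold E) (m : M) :
  tvsType R := E.

Section Maps.
Context {R : realType} {E F : tvsType R} {M : manifold E} {N : manifold F}.

Definition smooth_map_on (D : set M) (f : M -> N) : Prop :=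
  {in D, continuous f} /\
  forall (phi : chart E M) (psi : chart F N), atlas phi -> atlas psi ->
    smooth_on [set x | [/\ chart_cod phi x, D (chart_inv phi x) &
                          chart_dom psi (f (chart_inv phi x))]]
      (psi \o f \o chart_inv phi).

Definition smooth_map (f : M -> N) : Prop := smooth_map_on setT f.

Definition tangent_map (f : M -> N) (m : M) (v : tangent m) : tangent (f m) :=
  dirder (chart_at (f m) \o f \o chart_inv (chart_at m)) (chart_at m m) v.

End Maps.

Section Tensors.
Context {R : realType} {E : tvsType R} {M : manifold E}.

Definition to_chart (phi : chart E M) (m : M) (v : tangent m) : E :=
  dirder (phi \o chart_inv (chart_at m)) (chart_at m m) v.

Definition of_chart (phi : chart E M) (x v : E) : tangent (chart_inv phi x) :=
  dirder (chart_at (chart_inv phi x) \o chart_inv phi) x v.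

Definition smooth_vector_field (X : forall m : M, tangent m) : Prop :=
  forall phi, atlas phi ->
    smooth_on (chart_cod phi)
      (fun x => to_chart phi (X (chart_inv phi x))).

Definition differential (h : M -> R) (m : M) (v : tangent m) : R :=
  dirder (h \o chart_inv (chart_at m) : E -> R^o) (chart_at m m) v.

(* Velocity at time t of the curve c, i.e. T_t c (1). *)
Definition velocity (c : R -> M) (t : R) : tangent (c t) :=
  dirder (chart_at (c t) \o c : R^o -> E) t 1.

Definition has_velocity (c : R -> M) (t : R) (v : tangent (c t)) : Prop :=
  continuous_at t c /\ has_dirder (chart_at (c t) \o c : R^o -> E) t 1 v.

(* Used for open intervals I; c is only required to be differentiable on I, the
   values of c outside I are irrelevant. *)
Definition integral_curve (X : forall m : M, tangent m) (I : set R)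
  (c : R -> M) : Prop := forall t, I t -> has_velocity (X (c t)).

(* A local flow of X is defined on an open neighbourhood D of {0} x M which
   meets each R x {m} in an interval. *)
Definition local_flow (X : forall m : M, tangent m)
    (D : set (prod_manifold (line R) M)) (Fl : prod_manifold (line R) M -> M)
    : Prop :=
  [/\ open D,
      forall m : M, D (0, m) /\ is_interval [set t : R | D (t, m)],
      smooth_map_on D Fl &
      forall m : M, Fl (0, m) = m /\
        integral_curve X [set t : R | D (t, m)] (fun t => Fl (t, m))].

Definition has_unique_local_flow (X : forall m : M, tangent m) : Prop :=
  (exists D Fl, local_flow X D Fl) /\
  forall D Fl D' Fl', local_flow X D Fl -> local_flow X D' Fl' ->
    forall p, D p -> D' p -> Fl p = Fl' p.

End Tensors.

Section SymplecticForms.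
Context {R : realType}.

Definition bilinear_form {V W : lmodType R} (b : V -> W -> R) : Prop :=
  (forall w, scalar (b^~ w)) /\ (forall v, scalar (b v)).

Definition weakly_nondegenerate {V W : lmodType R} (b : V -> W -> R) : Prop :=
  (forall v, (forall w, b v w = 0) -> v = 0) /\
  (forall w, (forall v, b v w = 0) -> w = 0).

Context {E : tvsType R} {M : manifold E}.
Variable omega : forall m : M, tangent m -> tangent m -> R.

Definition local_form (phi : chart E M) (x u v : E) : R^o :=
  omega (of_chart phi x u) (of_chart phi x v).

Definition two_form : Prop :=
  [/\ forall m, bilinear_form (@omega m),
      forall m (v : tangent m), omega v v = 0 &
      forall phi, atlas phi ->
        smooth_on (chart_cod phi `*` setT)
          (fun p : E * (E * E) => local_form phi p.1 p.2.1 p.2.2)].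

(* In a chart, d omega (u, v, w) for constant vector fields u, v, w. *)
Definition closed_form : Prop :=
  forall (phi : chart E M) (x u v w : E), atlas phi -> chart_cod phi x ->
    dirder (fun y => local_form phi y v w) x u
    - dirder (fun y => local_form phi y u w) x v
    + dirder (fun y => local_form phi y u v) x w = 0.

Definition symplectic_form : Prop :=
  [/\ two_form, closed_form & forall m, weakly_nondegenerate (@omega m)].

Definition hamiltonian_vector_field (h : M -> R) (X : forall m : M, tangent m)
    : Prop :=
  smooth_vector_field X /\
  forall (m : M) (Y : tangent m), omega (X m) Y = - differential h Y.

End SymplecticForms.

Record lie_group (R : realType) (E : tvsType R) := LieGroup {
  lie_manifold :> manifold E;
  lmul : lie_manifold -> lie_manifold -> lie_manifold;
  lone : lie_manifold;
  linv : lie_manifold -> lie_manifold;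
  lmulA : associative lmul;
  lmul1 : left_id lone lmul;
  lmulV : left_inverse lone linv lmul;
  smooth_lmul : smooth_map (M := prod_manifold lie_manifold lie_manifold)
    (fun p => lmul p.1 p.2);
  smooth_linv : smooth_map linv
}.

Definition lie_algebra {R : realType} {E : tvsType R} (G : lie_group E) :
  tvsType R := tangent (lone G).

Section LieGroups.
Context {R : realType} {E : tvsType R} {G : lie_group E}.

(* exp (t A) is the smooth one-parameter group with velocity A at t = 0; its
   velocity lives at exp 0 = 1. *)
Definition exponential_map (exp : lie_algebra G -> G) : Prop :=
  forall A : lie_algebra G,
  [/\ smooth_map (M := line R) (fun t : R => exp (t *: A)),
      forall s t : R, exp ((s + t) *: A) = lmul (exp (s *: A)) (exp (t *: A)) &
      has_velocity (c := fun t => exp (t *: A)) (t := 0) A].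

(* The value lies over J(m)^-1 * J(m) = 1. *)
Definition left_log_derivative {EM : tvsType R} {M : manifold EM} (J : M -> G)
    (m : M) (v : tangent m) : lie_algebra G :=
  tangent_map (lmul (linv (J m))) (tangent_map J v).

Context {EM : tvsType R} {M : manifold EM}.

Definition smooth_action (act : G -> M -> M) : Prop :=
  [/\ forall m, act (lone G) m = m,
      forall g k m, act (lmul g k) m = act g (act k m) &
      smooth_map (M := prod_manifold G M) (fun p => act p.1 p.2)].

(* A symplectic G-manifold: G acts smoothly by symplectomorphisms. *)
Definition symplectic_action (omega : forall m : M, tangent m -> tangent m -> R)
    (act : G -> M -> M) : Prop :=
  smooth_action act /\
  forall (g : G) (m : M) (u v : tangent m),
    omega _ (tangent_map (act g) u) (tangent_map (act g) v) = omega m u v.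

(* The velocity at t = 0 lies over exp 0 . m = m. *)
Definition fundamental_vector_field (exp : lie_algebra G -> G)
    (act : G -> M -> M) (A : lie_algebra G) (m : M) : tangent m :=
  velocity (fun t : R => act (exp (t *: A)) m) 0.

End LieGroups.

Definition dual_pair {R : realType} {E F : tvsType R} (G : lie_group E)
    (Gs : lie_group F) (kappa : lie_algebra G -> lie_algebra Gs -> R) : Prop :=
  bilinear_form kappa /\ weakly_nondegenerate kappa.

Definition group_valued_momentum_map {R : realType} {E F EM : tvsType R}
    {G : lie_group E} {Gs : lie_group F} {M : manifold EM}
    (kappa : lie_algebra G -> lie_algebra Gs -> R)
    (exp : lie_algebra G -> G) (act : G -> M -> M)
    (omega : forall m : M, tangent m -> tangent m -> R) (J : M -> Gs) : Prop :=
  smooth_map J /\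
  forall (A : lie_algebra G) (m : M) (X : tangent m),
    omega m (fundamental_vector_field exp act A m) X
    + kappa A (left_log_derivative J X) = 0.

(* Main.v *)
Require Import Defs.
From mathcomp Require Import all_boot all_order all_algebra.
From mathcomp Require Import all_classical all_reals all_analysis.
From mathcomp Require Import lra.

(* The momentum map relation and the antisymmetry of omega give
   kappa (A, delta J (X^h)) = omega (X^h, A_M) = - dh (A_M), where A_M is the
   fundamental vector field of A.  This vanishes because h is constant along
   t |-> exp (tA) . m.  Weak nondegeneracy of kappa then gives
   delta J (X^h) = 0, hence TJ (X^h) = 0 as left translations are invertible.
   So J o c has zero velocity for any integral curve c of X^h.
   A curve with zero velocity is locally constant by a mean value inequality
   for convex neighbourhoods, hence constant on an interval.

   An integral curve is only differentiable, and the spaces are only locally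
   convex: the chain rule for a C^1 map along such a curve also rests on the
   mean value inequality. *)

Set Implicit Arguments.
Unset Strict Implicit.
Unset Printing Implicit Defensive.

Import Order.TTheory GRing.Theory Num.Theory.
Import numFieldNormedType.Exports.

Local Open Scope classical_set_scope.
Local Open Scope ring_scope.

(** Continuous induction: the local hypothesis at the supremum of the points [x] of [[a, b]] with
    [P a x] shows that this supremum is attained and cannot lie below [b]. *)
Lemma interval_chaining (R : realType) (P : R -> R -> Prop) (a b : R) :
  a <= b -> (forall x y z, P x y -> P y z -> P x z) ->
  (forall r, a <= r <= b -> \forall x \near r,
     (x <= r -> P x r) /\ (r <= x -> P r x)) ->
  P a b.
Proof.
move=> ab Ptr Ploc; pose S := [set x | a <= x <= b /\ P a x].
have Sa : S a.
  split; first by rewrite lexx.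
  have /Ploc/nbhs_singleton[_] : a <= a <= b by rewrite lexx.
  by apply.
have hS : has_sup S.
  by split; [exists a|exists b => x [/andP[]]].
have a_s : a <= sup S by apply: ub_le_sup => //; case: hS.
have s_b : sup S <= b by apply: ge_sup; [exists a|move=> x [/andP[]]].
have /Ploc/nbhs_ballP[e /= e0 He] : a <= sup S <= b by rewrite a_s.
have [x [xab Pax] xs] := sup_adherent e0 hS.
have xles : x <= sup S by apply: ub_le_sup => //; case: hS.
have Pas : P a (sup S).
  apply: Ptr Pax _; have [|+ _] := He x; last exact.
  by rewrite /ball /= ger0_norm ?subr_ge0//; lra.
move: s_b; rewrite le_eqVlt => /predU1P[<-//|sb].
(* A point strictly beyond the supremum, still in [[a, b]] and in the ball of radius [e]. *)
pose y := Num.min b (sup S + e / 2).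
have sy : sup S < y by rewrite lt_min sb ltrDl divr_gt0.
suff : y <= sup S by rewrite leNgt sy.
apply: ub_le_sup; first by case: hS.
split; first by rewrite (le_trans a_s (ltW sy)) ge_min lexx.
apply: Ptr Pas _; have [|_] := He y; last by apply; exact: ltW.
rewrite /ball /= ltr0_norm ?subr_lt0// opprB ltrBlDl.
by rewrite gt_min ltrD2l ltr_pdivrMr// mulr_natr mulr2n ltrDl e0 orbT.
Qed.

(** * Differential calculus along curves in locally convex spaces *)

Section LocallyConvexCalculus.
Context {R : realType}.
Implicit Types E F : tvsType R.

Lemma convex_set_combination E (C : set E) (x y : E) (k l : R) :
  convex_set (C : set (convex_lmodType E)) -> C x -> C y ->
  0 <= k -> 0 <= l -> k + l = 1 -> C (k *: x + l *: y).
Proof.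
move=> cC Cx Cy k0 l0 kl.
have k1 : k <= 1 by rewrite -kl lerDl.
have := cC x y (Itv01 k0 k1) (mem_set Cx) (mem_set Cy).
move/set_mem; suff -> : l = 1 - k by [].
by rewrite -kl addrAC subrr add0r.
Qed.

Lemma nbhs_convex E (x : E) (A : set E) : nbhs x A ->
  exists C : set E,
    [/\ open C, convex_set (C : set (convex_lmodType E)), C x & C `<=` A].
Proof.
have [B Bc [Bo Bn]] := @locally_convex R E.
move=> /Bn[C [BC Cx] CA]; exists C; split => //; first exact: Bo.
exact/Bc/mem_set.
Qed.

Lemma has_dirder_unique E F (f : E -> F) x v w1 w2 : hausdorff_space F ->
  has_dirder f x v w1 -> has_dirder f x v w2 -> w1 = w2.
Proof. by move=> hF; exact: (cvg_unique hF). Qed.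

(** Existence makes [dirder] a true derivative rather than its default value, and limits in a
    Hausdorff space are unique. *)
Lemma dirderE E F (f : E -> F) x v w : hausdorff_space F ->
  has_dirder f x v w -> dirder f x v = w.
Proof.
move=> hF fw; apply: (has_dirder_unique hF) (fw).
by apply: (@xgetPex _ 0 [set w | has_dirder f x v w]); exists w.
Qed.

Lemma has_dirder0 E F (f : E -> F) x : has_dirder f x 0 0.
Proof.
rewrite /has_dirder (_ : diff_quotient f x 0 = cst 0); first exact: cvg_cst.
by apply/funext => t; rewrite /diff_quotient scaler0 addr0 subrr scaler0.
Qed.

Lemma has_dirder_cst E F (a : F) (x v : E) : has_dirder (fun=> a) x v 0.
Proof.
rewrite /has_dirder (_ : diff_quotient _ x v = cst 0); first exact: cvg_cst.
by apply/funext => t; rewrite /diff_quotient subrr scaler0.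
Qed.

(** Clearing the denominator gives a form that also covers [x = t]. *)
Lemma has_dirder_near F (c : R -> F) (t : R) (w : F) (C : set F) :
  has_dirder (c : R^o -> F) t 1 w -> nbhs w C ->
  \forall x \near t, exists2 w', C w' & c x - c t = (x - t) *: w'.
Proof.
move=> cw nC; have := cw _ nC; rewrite /= => cC.
have xt : x - t @[x --> t] --> (0 : R).
  by rewrite -(subrr t); apply: cvgB; [exact: cvg_id|exact: cvg_cst].
have := xt _ cC; rewrite /= => {}xt.
near=> x; have [->|nxt] := eqVneq x t.
  by exists w; [exact: nbhs_singleton|rewrite !subrr scale0r].
exists (diff_quotient (c : R^o -> F) t 1 (x - t)).
  have : x - t != 0 by rewrite subr_eq0.
  by near: x.
rewrite /diff_quotient scalerA divff ?subr_eq0// scale1r.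
by rewrite [_ *: 1]mulr1 [t + _]addrC subrK.
Unshelve. all: by end_near. Qed.

(* Mean value theorem without functionals: the difference quotients over
   adjacent intervals average to the one over their union, and C is convex. *)
Lemma mean_value_convex F (c g : R -> _) (a b : R) (C : set F) :
  a <= b -> convex_set (C : set (convex_lmodType F)) ->
  (forall r, a <= r <= b ->
     has_dirder (c : R^o -> F) r 1 (g r) /\ nbhs (g r) C) ->
  exists2 w, C w & c b - c a = (b - a) *: w.
Proof.
move=> ab cC cg.
(* [P] carries the order, so that the weights in the transitivity step are nonnegative. *)
pose P x y := x <= y /\ exists2 w, C w & c y - c x = (y - x) *: w.
suff [] : P a b by [].
apply: interval_chaining => //.
  move=> x y z [xy [w1 Cw1 e1]] [yz [w2 Cw2 e2]].
  split; first exact: le_trans yz.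
  have [xz|xz] := eqVneq x z.
    by exists w1 => //; rewrite xz !subrr scale0r.
  have zx : 0 < z - x by rewrite subr_gt0 lt_neqAle xz (le_trans xy yz).
  exists (((y - x) / (z - x)) *: w1 + ((z - y) / (z - x)) *: w2).
    apply: convex_set_combination => //.
    - by apply: divr_ge0; rewrite ?(ltW zx) ?subr_ge0.
    - by apply: divr_ge0; rewrite ?(ltW zx) ?subr_ge0.
    - by rewrite -mulrDl addrC addrA subrK divff// gt_eqF.
  rewrite scalerDr !scalerA ![(z - x) * _]mulrC !divfK ?gt_eqF//.
  by rewrite -e1 -e2 [RHS]addrC addrA subrK.
move=> r /cg[cr nr]; apply: filterS (has_dirder_near cr nr) => x [w Cw cx].
split=> h; split=> //; exists w => //.
by rewrite -opprB cx -scaleNr opprB.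
Qed.

Lemma has_dirder_cvg F (c : R -> F) (t : R) (w : F) :
  has_dirder (c : R^o -> F) t 1 w -> c (t + s) @[s --> (0 : R)^'] --> c t.
Proof.
move=> cw.
have -> : c t = c t + (0 : R) *: w by rewrite scale0r addr0.
have : c t + s *: diff_quotient (c : R^o -> F) t 1 s @[s --> (0 : R)^'] -->
   c t + (0 : R) *: w.
  apply: (@continuous2_cvg _ _ _ _ _ _ _ _ (fun x y : F => x + y)).
  - exact: (@add_continuous F (_, _)).
  - exact: cvg_cst.
  apply: (@continuous2_cvg R R^o F F _ _ _ _ (fun x y => x *: y)) => //.
  - exact: (@scale_continuous R F (_, _)).
  - exact: nbhs_dnbhs.
apply: cvg_trans; apply: near_eq_cvg; near=> s.
rewrite /diff_quotient scalerA divff; last by near: s; exact: nbhs_dnbhs_neq.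
by rewrite scale1r [s *: 1]mulr1 addrC subrK.
Unshelve. all: by end_near. Qed.

(** For fixed small [s], the curve is replaced by the segment [c t + r q], where [q] is its
    difference quotient. Both agree at the endpoints [r = 0] and [r = s], and [f] has derivative
    [df (c t + r q, q)] along the segment, close to [df (c t, w)]; the mean value theorem
    applies. *)
Lemma has_dirder_comp E F (U : set E) (f : E -> F) (df : E * E -> F)
    (c : R -> E) (t : R) (w : E) :
  nbhs (c t) U -> (forall x v, U x -> has_dirder f x v (df (x, v))) ->
  {for (c t, w), continuous df} ->
  has_dirder (c : R^o -> E) t 1 w ->
  has_dirder (f \o c : R^o -> F) t 1 (df (c t, w)).
Proof.
move=> nU fdf dfc cw A /nbhs_convex[C [oC cC Cw CA]].
have [[V W] /= [nV nW] VWC] := dfc _ (open_nbhs_nbhs (conj oC Cw)).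
(* Convexity of [V'] keeps the segment from [c t] to [c (t + s)] inside both [V] and [U]. *)
have [V' [oV' cV' V'c V'VU]] := nbhs_convex (filterI nV nU).
have /= nV' := has_dirder_cvg cw (open_nbhs_nbhs (conj oV' V'c)).
have /= nW' := cw _ nW.
suff : \forall s \near (0 : R)^', A (diff_quotient (f \o c : R^o -> F) t 1 s).
  by [].
near=> s; apply: CA.
have s0 : s != 0 by near: s; exact: nbhs_dnbhs_neq.
have Vcs : V' (c (t + s)) by near: s.
have Wq : W (diff_quotient (c : R^o -> E) t 1 s) by near: s.
set q := diff_quotient _ _ _ _ in Wq.
have cts : c (t + s) = c t + s *: q.
  rewrite /q /diff_quotient scalerA divff// scale1r [s *: 1]mulr1.
  by rewrite [RHS]addrC subrK.
clearbody q.
(* The condition on [r / s] describes the segment for either sign of [s]. *)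
have Vr r : 0 <= r / s <= 1 -> V' (c t + r *: q).
  move=> /andP[r0 r1].
  have -> : c t + r *: q = (1 - r / s) *: c t + (r / s) *: c (t + s).
    by rewrite cts scalerDr scalerA divfK// addrA -scalerDl subrK scale1r.
  by apply: convex_set_combination; rewrite ?subr_ge0 ?subrK.
pose gam (r : R) := f (c t + r *: q).
have Hg r : 0 <= r / s <= 1 ->
    has_dirder (gam : R^o -> F) r 1 (df (c t + r *: q, q)) /\
    nbhs (df (c t + r *: q, q)) C.
  move=> /Vr /V'VU[Vx Ux]; split; last first.
    by apply: open_nbhs_nbhs; split => //; exact: (VWC (_, _)).
  have := fdf _ q Ux; rewrite /has_dirder (_ : diff_quotient f _ q =
    diff_quotient (gam : R^o -> F) r 1)//.
  apply/funext => u; rewrite /diff_quotient /gam.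
  by rewrite scalerDl addrA [u *: 1]mulr1.
have -> : diff_quotient (f \o c : R^o -> F) t 1 s =
    s^-1 *: (gam s - gam 0).
  by rewrite /diff_quotient /gam /= [s *: 1]mulr1 cts scale0r addr0.
have MV (a b : R) : a <= b -> (forall r, a <= r <= b -> 0 <= r / s <= 1) ->
    exists2 y, C y & gam b - gam a = (b - a) *: y.
  move=> ab rs; apply: (@mean_value_convex _ _ (fun r => df (c t + r *: q, q)))
    => // r /rs; exact: Hg.
have [sp|] := ltP 0 s.
  have [|y Cy ->] := MV 0 s (ltW sp); last first.
    by rewrite subr0 scalerA mulVf// scale1r.
  by move=> r /andP[r0 rs]; rewrite divr_ge0 ?(ltW sp)//= ler_pdivrMr// mul1r.
rewrite le_eqVlt (negbTE s0) /= => sn.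
have [|y Cy e] := MV s 0 (ltW sn); last first.
  by rewrite -opprB e sub0r scaleNr opprK scalerA mulVf// scale1r.
move=> r /andP[rs r0]; rewrite ler_ndivrMr// mul1r rs andbT.
by rewrite mulr_le0// invr_le0 ltW.
Unshelve. all: by end_near. Qed.

Lemma cvg_line E (x v : E) : x + s *: v @[s --> (0 : R)] --> x.
Proof.
rewrite -[X in _ --> X]addr0 -(scale0r v).
apply: (@continuous2_cvg _ _ _ _ _ _ _ _ (fun x y : E => x + y)).
- exact: (@add_continuous E (_, _)).
- exact: cvg_cst.
apply: (@continuous2_cvg R R^o E E _ _ _ _ (fun x y => x *: y)).
- exact: (@scale_continuous R E (_, _)).
- exact: cvg_id.
- exact: cvg_cst.
Qed.

(** Lets derivatives along curves determine directional derivatives. *)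
Lemma has_dirder_line E F (f : E -> F) (x v : E) (w : F) :
  has_dirder (fun s : R^o => f (x + s *: v)) 0 1 w <-> has_dirder f x v w.
Proof.
rewrite /has_dirder (_ : diff_quotient _ (0 : R^o) 1 = diff_quotient f x v)//.
apply/funext => s.
by rewrite /diff_quotient add0r scale0r addr0 [s *: 1]mulr1.
Qed.

Lemma has_dirder_near_eq F (c d : R -> F) (t : R) (w : F) :
  (\forall s \near t, c s = d s) ->
  has_dirder (c : R^o -> F) t 1 w -> has_dirder (d : R^o -> F) t 1 w.
Proof.
move=> cd; apply: cvg_trans; apply: near_eq_cvg.
have := @cvg_line R^o t 1 _ cd; rewrite /= => /nbhs_dnbhs {}cd'.
have cdt : c t = d t by exact: nbhs_singleton cd.
by near=> s; rewrite /diff_quotient -cdt; congr (_ *: (_ - _)); near: s.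
Unshelve. all: by end_near. Qed.

Lemma has_dirder_smooth E F (U : set E) (f : E -> F) (c : R -> E) (t : R)
    (w : E) :
  hausdorff_space F -> smooth_on U f -> nbhs (c t) U ->
  has_dirder (c : R^o -> E) t 1 w ->
  has_dirder (f \o c : R^o -> F) t 1 (dirder f (c t) w).
Proof.
move=> hF /(_ 1)/= [_ [df fdf dfc]] nU cw.
rewrite (dirderE hF (fdf _ w (nbhs_singleton nU))).
apply: (has_dirder_comp nU fdf _ cw); apply: dfc; apply/mem_set.
by split => //; exact: nbhs_singleton nU.
Qed.

(** By the mean value theorem, the quotient of [c b - c a] by [b - a] lies in every neighbourhood of
    0, so it vanishes in a Hausdorff space. *)
Lemma zero_derivative_constant F (c : R -> F) (a b : R) :
  hausdorff_space F -> a <= b ->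
  (forall r, a <= r <= b -> has_dirder (c : R^o -> F) r 1 0) -> c a = c b.
Proof.
move=> hF; rewrite le_eqVlt => /predU1P[->//|ab] c0.
apply/esym/eqP; rewrite -subr_eq0; apply/eqP.
have ba : b - a != 0 by rewrite subr_eq0 gt_eqF.
suff /(congr1 ( *:%R (b - a))) : 0 = (b - a)^-1 *: (c b - c a).
  by rewrite scaler0 scalerA divff// scale1r.
apply: hF => A B /nbhs_convex[C [oC cC C0 CA]] nB.
have [|w Cw e] := @mean_value_convex F c (fun=> 0) a b C (ltW ab) cC.
  by move=> r /c0; split => //; exact: open_nbhs_nbhs.
exists w; split; first exact: CA.
by have := nbhs_singleton nB; rewrite e scalerA mulVf// scale1r.
Qed.

End LocallyConvexCalculus.

(** * Derivatives of curves in manifolds, read in charts *)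

Section Curves.
Context {R : realType} {E F : tvsType R} {M : manifold E} {N : manifold F}.

Lemma atlas_chart_at (m : M) : atlas (chart_at m).
Proof. by rewrite /chart_at; case: cid2. Qed.

Lemma dom_chart_at (m : M) : chart_dom (chart_at m) m.
Proof. by rewrite /chart_at; case: cid2. Qed.

Lemma near_chart_dom (phi : chart E M) (c : R -> M) (t : R) :
  {for t, continuous c} -> chart_dom phi (c t) ->
  \forall s \near t, chart_dom phi (c s).
Proof.
move=> cc ct; apply: cc; apply: open_nbhs_nbhs; split => //.
exact: open_chart_dom.
Qed.

Lemma smooth_map_continuous_comp (f : M -> N) (c : R -> M) (t : R) :
  smooth_map f -> {for t, continuous c} -> {for t, continuous (f \o c)}.
Proof.
by move=> [fc _] cc; apply: continuous_comp => //; exact/fc/mem_set.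
Qed.

(** The chain rule for the local representative of [f]. The charts are arbitrary, so [f = id] gives
    the change of charts. *)
Lemma has_dirder_chart (f : M -> N) (phi : chart E M) (psi : chart F N)
    (c : R -> M) (t : R) (v : E) :
  smooth_map f -> atlas phi -> atlas psi -> {for t, continuous c} ->
  chart_dom phi (c t) -> chart_dom psi (f (c t)) ->
  has_dirder (phi \o c : R^o -> E) t 1 v ->
  has_dirder (psi \o f \o c : R^o -> F) t 1
    (dirder (psi \o f \o chart_inv phi) (phi (c t)) v).
Proof.
move=> [fc fs] aphi apsi cc phic psic cv.
apply: (@has_dirder_near_eq _ _ ((psi \o f \o chart_inv phi) \o (phi \o c))).
  near=> s; rewrite /= chart_funK//.
  by near: s; exact: near_chart_dom.
apply: (has_dirder_smooth (hausdorff_model N) (fs _ _ aphi apsi) _ cv).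
have codc : chart_cod phi (phi (c t)) by exact: chart_funP.
(* Continuity of [f] makes the domain of the local representative a neighbourhood. *)
have nD : nbhs (phi (c t)) (chart_inv phi @^-1` (f @^-1` chart_dom psi)).
  apply: (continuous_chart_inv (mem_set codc)).
  rewrite chart_funK//; apply: (fc _ (mem_set I)).
  by apply: open_nbhs_nbhs; split => //; exact: open_chart_dom.
have nC : nbhs (phi (c t)) (chart_cod phi).
  by apply: open_nbhs_nbhs; split => //; exact: open_chart_cod.
by apply: filterS (filterI nC nD) => x [].
Unshelve. all: by end_near. Qed.

End Curves.

(** * Straight lines in charts and curves of zero velocity *)

Section CurvesInCharts.
Context {R : realType} {E : tvsType R} {M : manifold E}.

Lemma smooth_map_id : smooth_map (@id M).
Proof.
split; first by move=> x _; exact: cvg_id.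
move=> phi psi aphi apsi k; apply: Ck_on_sub (atlas_compat aphi apsi k).
by move=> x [].
Qed.

(** Realises a coordinate vector as the velocity of a curve; the line stays in the chart only for
    small [s]. *)
Lemma chart_line (phi : chart E M) (m : M) (v : E)
    (c := fun s : R => chart_inv phi (phi m + s *: v)) :
  chart_dom phi m ->
  [/\ c 0 = m, {for 0, continuous c} & has_dirder (phi \o c : R^o -> E) 0 1 v].
Proof.
move=> pm; have c0 : c 0 = m by rewrite /c scale0r addr0 chart_funK.
have codm : chart_cod phi (phi m) by exact: chart_funP.
split => //.
  change (c s @[s --> (0 : R)] --> c 0).
  rewrite c0 -[X in _ --> X](chart_funK pm).
  apply: (@cvg_comp _ _ _ (fun s : R => phi m + s *: v) (chart_inv phi) _
    (nbhs (phi m))); first exact: cvg_line.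
  exact: (continuous_chart_inv (mem_set codm)).
apply: (@has_dirder_near_eq _ _ (fun s : R => phi m + s *: v)); last first.
  by apply/(has_dirder_line id); exact: has_dirder_linear.
have : \forall s \near (0 : R), chart_cod phi (phi m + s *: v).
  apply: (@cvg_line _ _ (phi m) v); apply: open_nbhs_nbhs; split => //.
  exact: open_chart_cod.
by apply: filterS => s ?; rewrite /c /= chart_invK.
Qed.

(* Derivatives of c are taken in the chart preferred at each point, which
   varies with the point, so they are first transported to a common chart. *)
Lemma zero_velocity_constant (I : set R) (c : R -> M) :
  open I -> is_interval I -> integral_curve (fun m => 0 : tangent m) I c ->
  forall s t, I s -> I t -> c s = c t.
Proof.
move=> oI iI c0 s t.
wlog st : s t / s <= t.
  by move=> H Is It; have [/H->//|/ltW/H->] := leP s t.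
move=> Is It; apply: (@interval_chaining _ (fun x y => c x = c y)) => //.
  by move=> x y z -> ->.
move=> r rst; have Ir : I r by exact: iI Is It _ rst.
have [cr _] := c0 _ Ir.
have psir := dom_chart_at (c r).
set psi := chart_at (c r) in psir.
have apsi : atlas psi by exact: atlas_chart_at.
have nI : nbhs r I by exact: open_nbhs_nbhs.
have : nbhs r (I `&` c @^-1` chart_dom psi).
  by apply: filterI nI _; exact: near_chart_dom.
move=> /nbhs_ballP[e /= e0 He].
have psi0 y : ball r e y -> has_dirder (psi \o c : R^o -> E) y 1 0.
  move=> /He[Iy psiy]; have [cy vy] := c0 _ Iy.
  have := has_dirder_chart smooth_map_id (atlas_chart_at (c y)) apsi cy
    (dom_chart_at _) psiy vy.
  (* The change of charts sends the zero vector to zero. *)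
  by rewrite (dirderE (hausdorff_model M) (has_dirder0 _ _)).
have const x y : x <= y -> ball r e x -> ball r e y -> c x = c y.
  move=> xy bx by_; have [_ px] := He _ bx; have [_ py] := He _ by_.
  rewrite -(chart_funK px) -(chart_funK py); congr chart_inv.
  apply: (zero_derivative_constant (hausdorff_model M) xy (c := psi \o c)).
  move=> z /andP[xz zy]; apply: psi0; move: bx by_.
  rewrite /ball /= !ltr_norml => /andP[? ?] /andP[? ?]; apply/andP; split; lra.
near=> x; have bx : ball r e x by near: x; exact: nbhsx_ballx.
by split=> h; apply: const => //; exact: ballxx.
Unshelve. all: by end_near. Qed.

End CurvesInCharts.

(** * Curves in products of manifolds *)

Section Products.
Context {R : realType} {E1 E2 F : tvsType R}.
Context {M1 : manifold E1} {M2 : manifold E2} {N : manifold F}.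

Lemma has_dirder_chart2 (f : M1 * M2 -> N) (phi1 : chart E1 M1)
    (phi2 : chart E2 M2) (psi : chart F N) (c1 : R -> M1) (c2 : R -> M2)
    (t : R) (v1 : E1) (v2 : E2) :
  smooth_map (M := prod_manifold M1 M2) f ->
  atlas phi1 -> atlas phi2 -> atlas psi ->
  {for t, continuous c1} -> {for t, continuous c2} ->
  chart_dom phi1 (c1 t) -> chart_dom phi2 (c2 t) ->
  chart_dom psi (f (c1 t, c2 t)) ->
  has_dirder (phi1 \o c1 : R^o -> E1) t 1 v1 ->
  has_dirder (phi2 \o c2 : R^o -> E2) t 1 v2 ->
  has_dirder (fun s : R^o => psi (f (c1 s, c2 s))) t 1
    (dirder (psi \o f \o chart_inv (prod_chart phi1 phi2))
      (phi1 (c1 t), phi2 (c2 t)) (v1, v2)).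
Proof.
move=> fs a1 a2 apsi cc1 cc2 d1 d2 dpsi h1 h2.
apply: (@has_dirder_chart _ _ _ (prod_manifold M1 M2) N f
  (prod_chart phi1 phi2) psi (fun s => (c1 s, c2 s))) => //.
- by exists phi1, phi2.
- exact: cvg_pair.
exact: (cvg_pair h1 h2).
Qed.

Lemma smooth_map_continuous_comp2 (f : M1 * M2 -> N) (c1 : R -> M1)
    (c2 : R -> M2) (t : R) :
  smooth_map (M := prod_manifold M1 M2) f ->
  {for t, continuous c1} -> {for t, continuous c2} ->
  {for t, continuous (fun s => f (c1 s, c2 s))}.
Proof.
move=> fs cc1 cc2.
apply: (@smooth_map_continuous_comp _ _ _ (prod_manifold M1 M2) N f
  (fun s => (c1 s, c2 s)) t fs).
exact: cvg_pair.
Qed.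

End Products.

(** * Tangent maps of left translations *)

Section LeftTranslation.
Context {R : realType} {E : tvsType R} {G : lie_group E}.

Lemma has_dirder_lmul (g : G) (phi psi : chart E G) (c : R -> G) (t : R)
    (v : E) :
  atlas phi -> atlas psi -> {for t, continuous c} ->
  chart_dom phi (c t) -> chart_dom psi (lmul g (c t)) ->
  has_dirder (phi \o c : R^o -> E) t 1 v ->
  has_dirder (psi \o lmul g \o c : R^o -> E) t 1
    (dirder (psi \o lmul g \o chart_inv phi) (phi (c t)) v).
Proof.
move=> aphi apsi cc dphi dpsi cv.
(* Multiplication along the pair of the constant curve [g] and [d] has a derivative depending only
   on [c t] and [v]. Applied to a straight line, this identifies it with the [dirder] of [lmul g];
   applied to [c], it gives the claim. *)
have D (d : R -> G) (r : R) : {for r, continuous d} -> d r = c t ->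
    has_dirder (phi \o d : R^o -> E) r 1 v ->
    has_dirder (psi \o lmul g \o d : R^o -> E) r 1
      (dirder (psi \o (fun p : G * G => lmul p.1 p.2) \o
        chart_inv (prod_chart (chart_at g) phi))
          (chart_at g g, phi (c t)) (0, v)).
  move=> dc dr dv; rewrite -dr; apply: (has_dirder_chart2 (@smooth_lmul _ _ G)
    (c1 := fun=> g)); rewrite ?dr //=.
  - exact: atlas_chart_at.
  - exact: cvg_cst.
  - exact: dom_chart_at.
  - exact: has_dirder_cst.
have [l0 lc lv] := chart_line v dphi.
have /(has_dirder_line (psi \o lmul g \o chart_inv phi)) := D _ _ lc l0 lv.
by move=> /(dirderE (hausdorff_model G)) ->; exact: D.
Qed.

Lemma continuous_lmul (g : G) (c : R -> G) (t : R) :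
  {for t, continuous c} -> {for t, continuous (lmul g \o c)}.
Proof.
move=> cc; apply: (smooth_map_continuous_comp2 (c1 := fun=> g)
  (@smooth_lmul _ _ G)) => //; exact: cvg_cst.
Qed.

(** A curve with velocity [w] is translated by [g] and then by its inverse: it returns to itself,
    but with velocity zero. *)
Lemma tangent_lmul_eq0 (g k : G) (w : tangent k) :
  tangent_map (lmul g) w = 0 -> w = 0.
Proof.
move=> w0; have [l [l0 lc lv]] : exists l : R -> G, [/\ l 0 = k,
    {for 0, continuous l} & has_dirder (chart_at k \o l : R^o -> E) 0 1 w].
  by eexists; apply: chart_line; exact: dom_chart_at.
have := @has_dirder_lmul g (chart_at k) (chart_at (lmul g k)) l 0 w
  (atlas_chart_at _) (atlas_chart_at _) lc.
rewrite l0 => /(_ (dom_chart_at _) (dom_chart_at _) lv) gl.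
rewrite /tangent_map in w0; rewrite w0 in gl.
have gK x : lmul (linv g) (lmul g x) = x by rewrite lmulA lmulV lmul1.
have := @has_dirder_lmul (linv g) (chart_at (lmul g k)) (chart_at k)
  (lmul g \o l) 0 0 (atlas_chart_at _) (atlas_chart_at _)
  (continuous_lmul lc).
rewrite /= gK l0 => /(_ (dom_chart_at _) (dom_chart_at _) gl).
rewrite (dirderE (hausdorff_model G) (has_dirder0 _ _)).
rewrite (_ : _ \o _ = chart_at k \o l); last first.
  by apply/funext => s /=; rewrite gK.
exact: has_dirder_unique (hausdorff_model G) lv.
Qed.

End LeftTranslation.

(** * Fundamental vector fields and invariant functions *)

Section FundamentalVectorField.
Context {R : realType} {EG EM : tvsType R} {G : lie_group EG} {M : manifold EM}.
Variables (expG : lie_algebra G -> G) (act : G -> M -> M).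
Hypotheses (expP : exponential_map expG) (actP : smooth_action act).

(** The one-parameter law at [s = t = 0] makes this element idempotent, and the only idempotent of a
    group is its identity. *)
Lemma exponential_map0 (A : lie_algebra G) : expG (0 *: A) = lone G.
Proof.
have [_ /(_ 0 0) e _] := expP A; move: e; rewrite addr0.
move: (expG _) => x xx.
by rewrite -[x]lmul1 -(lmulV x) -lmulA -xx.
Qed.

(* The curve exp (tA) . m has a derivative at 0, so that the total operator
   [velocity] does not return its junk value. *)
Lemma fundamental_has_velocity (A : lie_algebra G) (m : M)
    (e := fun t : R => act (expG (t *: A)) m) :
  [/\ e 0 = m, {for 0, continuous e} &
  has_dirder (chart_at m \o e : R^o -> EM) 0 1
    (fundamental_vector_field expG act A m)].
Proof.
have [act1 _ acts] := actP; have [_ _ [ec ev]] := expP A.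
have e0 : e 0 = m by rewrite /e exponential_map0 act1.
have em : {for 0, continuous e}.
  apply: (smooth_map_continuous_comp2 (c2 := fun=> m) acts) => //.
  exact: cvg_cst.
split => //.
have mc : {for (0 : R), continuous (fun=> m)} by exact: cvg_cst.
have := has_dirder_chart2 acts (c2 := fun=> m) (psi := chart_at m)
  (atlas_chart_at _) (atlas_chart_at _) (atlas_chart_at _) ec
  mc (dom_chart_at _) (dom_chart_at m) _ ev (has_dirder_cst _ _ _).
rewrite /= -/(e 0) e0 => /(_ (dom_chart_at m)) ed.
(* [velocity] uses the chart preferred at [e 0], which [e0] turns into the one at [m]. *)
rewrite /fundamental_vector_field /velocity -/(e 0) e0.
by rewrite (dirderE (hausdorff_model M) ed).
Qed.

Lemma differential_fundamental (h : M -> R) (A : lie_algebra G) (m : M) :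
  smooth_map (N := line R) h -> (forall g m, h (act g m) = h m) ->
  differential h (fundamental_vector_field expG act A m) = 0.
Proof.
move=> hs hinv; have [e0 ec ev] := fundamental_has_velocity A m.
have hausR : hausdorff_space R^o := hausdorff_model (line R).
(* In the identity chart of the line, the chain rule yields [differential h] itself. *)
have := has_dirder_chart (N := line R) (psi := id_chart R^o) hs
  (atlas_chart_at m) erefl ec.
rewrite e0 => /(_ _ (dom_chart_at m) I ev).
rewrite (_ : _ \o _ = cst (h m)); last by apply/funext => t /=; rewrite hinv.
move=> /(has_dirder_unique hausR); apply; exact: has_dirder_cst.
Qed.

End FundamentalVectorField.

(** * Conservation of the momentum map *)

Lemma alternating_antisymmetric (R : realType) (V : lmodType R)
    (b : V -> V -> R) (u v : V) :
  bilinear_form b -> (forall w, b w w = 0) -> b u v = - b v u.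
Proof.
move=> [bl br] alt; have := alt (u + v).
have := bl (u + v) 1 u v; rewrite scale1r mul1r => ->.
have := br u 1 u v; rewrite scale1r mul1r => ->.
have := br v 1 u v; rewrite scale1r mul1r => ->.
by rewrite !alt add0r addr0 => /eqP; rewrite addr_eq0 => /eqP.
Qed.

Theorem proposition2p13 (R : realType) (EM EG EGs : tvsType R)
    (M : manifold EM) (G : lie_group EG) (Gs : lie_group EGs)
    (omega : forall m : M, tangent m -> tangent m -> R)
    (expG : lie_algebra G -> G) (act : G -> M -> M)
    (kappa : lie_algebra G -> lie_algebra Gs -> R) (J : M -> Gs)
    (h : M -> R) (Xh : forall m : M, tangent m) :
  symplectic_form omega ->
  exponential_map expG ->
  symplectic_action omega act ->
  dual_pair kappa ->
  group_valued_momentum_map kappa expG act omega J ->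
  smooth_map (N := line R) h ->
  hamiltonian_vector_field omega h Xh ->
  has_unique_local_flow Xh ->
  (forall (g : G) (m : M), h (act g m) = h m) ->
  forall (I : set R) (c : R -> M),
    open I -> is_interval I -> integral_curve Xh I c ->
    forall s t : R, I s -> I t -> J (c s) = J (c t).
Proof.
move=> [[obil oalt _] _ _] expP [actP _] [_ [_ kappar]] [Js Jmom] hs [_ Xham] _
  hinv I c oI iI cX.
apply: (zero_velocity_constant (c := J \o c) oI iI) => t It.
have [ct vt] := cX t It.
have JX : tangent_map J (Xh (c t)) = 0.
  apply: tangent_lmul_eq0 (linv (J (c t))) _ _ _.
  apply: kappar => A; have := Jmom A (c t) (Xh (c t)).
  (* Antisymmetry moves [Xh] to the first slot, where the Hamiltonian equation applies. *)
  rewrite (alternating_antisymmetric _ _ (obil _) (oalt _)) Xham.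
  by rewrite (differential_fundamental expP actP _ _ hs hinv) !oppr0 add0r.
split; first exact: smooth_map_continuous_comp.
(* The required velocity 0 is rewritten as the image of [Xh] under the tangent map of [J], the form
   given by the chain rule. *)
rewrite -JX.
exact: (has_dirder_chart Js (atlas_chart_at _) (atlas_chart_at _) ct
  (dom_chart_at _) (dom_chart_at _) vt).
Qed.
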